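(* Let $K$ be a field, $S=K[x_1,\ldots,x_n]$, $\mathbf c=(c_1,\ldots,c_n)$ an integer vector with all $c_i\ge 0$, and $\mathbf e=(1,\ldots,1)\in\mathbb Z^n$. Let $I\subset S$ be an equigenerated $\mathbf c$-bounded strongly stable ideal, generated in degree $d$. Then: (a) For all $\ell\geq 1$, $J_\ell(I)$ is a $(\mathbf c-\ell\mathbf e)$-bounded strongly stable ideal generated in degree $d-\ell$, and if $J_{\ell-1}(I)\neq 0$ then \[ J_\ell(I)=\bigl(u/x_n^{\ell}:\ u\in G(I),\ x_n^\ell\mid u \text{ and } \operatorname{Deg}(u/x_n^{\ell})\leq \mathbf c-\ell\mathbf e\bigr). \] (b) $\operatorname{sat}(I)$ is the maximal number $\ell$ for which there exists $u\in G(I)$ such that $x_n^\ell\mid u$ and $\operatorname{Deg}(u/x_n^\ell)\leq \mathbf c-\ell\mathbf e$.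
   Context: $\mathfrak m=(x_1,\ldots,x_n)$. For a monomial ideal $I$, $G(I)$ is its unique minimal set of monomial generators. For a monomial $u=x_1^{a_1}\cdots x_n^{a_n}$ put $\operatorname{Deg}(u)=(a_1,\ldots,a_n)$. Integer vectors are compared componentwise. For an integer vector $\mathbf b$, a monomial $u$ is $\mathbf b$-bounded if $\operatorname{Deg}(u)\le \mathbf b$ (so there are no $\mathbf b$-bounded monomials if some $b_i<0$). A monomial ideal $I$ is $\mathbf b$-bounded strongly stable if all $u\in G(I)$ are $\mathbf b$-bounded, and for all $u\in G(I)$ and all $i<j$ with $x_j\mid u$ for which $x_iu/x_j$ is $\mathbf b$-bounded, one has $x_iu/x_j\in I$. An ideal is equigenerated if it is non-zero and all its minimal monomial generators have the same degree; it is generated in degree $d$ if that degree is $d$. The zero ideal vacuously counts as bounded strongly stable and as generated in any degree. The saturation number is $\operatorname{sat}(I)=\min\{k\ge 0: I:\mathfrak m^k=I:\mathfrak m^{k+1}\}$. For a monomial ideal $I$ put $J_0(I)=I$, and for $\ell\ge 1$ let $J_\ell(I)$ be the ideal generated by the monomials in $(I:\mathfrak m^{\ell})\setminus (I:\mathfrak m^{\ell-1})$ (the residue classes of these monomials form the unique monomial $K$-basis of $(I:\mathfrak m^{\ell})/(I:\mathfrak m^{\ell-1})$). *)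

(* Defs.v *)
From mathcomp Require Import all_boot all_order all_algebra.
From mathcomp.multinomials Require Import mpoly.
Set Implicit Arguments.
Unset Strict Implicit.
Unset Printing Implicit Defensive.
Import GRing.Theory Num.Theory.
Local Open Scope ring_scope.

(* Monomials of K[x_0, ..., x_(n-1)] are represented by their exponent vectors
   m : 'X_{1..n}, the corresponding polynomial being 'X_[m]; divisibility of
   monomials is the componentwise order (_ <= _)%MM on exponents. *)

Section Ideals.
Variables (n : nat) (K : fieldType).
Local Notation S := {mpoly K[n]}.

(* Ideals are Prop-valued predicates: the ideals of ring_quotient are decidable
   and proper, whereas colon ideals may be the whole ring. *)
Definition is_ideal (I : S -> Prop) : Prop :=
  [/\ I 0, forall f g, I f -> I g -> I (f + g) & forall r f, I f -> I (r * f)].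

Definition ideal_eq (I J : S -> Prop) : Prop := forall f, I f <-> J f.

Definition ideal_nonzero (I : S -> Prop) : Prop := exists2 f, I f & f != 0.

Definition ideal_gen (A : S -> Prop) : S -> Prop :=
  fun f => forall J, is_ideal J -> (forall a, A a -> J a) -> J f.

Definition ideal_mul (I J : S -> Prop) : S -> Prop :=
  ideal_gen (fun f => exists a b, [/\ I a, J b & f = a * b]).

Definition ideal_exp (I : S -> Prop) (k : nat) : S -> Prop :=
  iter k (ideal_mul I) (fun=> True).

Definition ideal_colon (I J : S -> Prop) : S -> Prop :=
  fun f => forall g, J g -> I (f * g).

Definition maxid : S -> Prop := ideal_gen (fun f => exists i : 'I_n, f = 'X_i).

Definition monomial_gen (A : 'X_{1..n} -> Prop) : S -> Prop :=
  ideal_gen (fun f => exists2 m, A m & f = 'X_[m]).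

Definition monomial_ideal (I : S -> Prop) : Prop :=
  exists A, ideal_eq I (monomial_gen A).

Definition minimal_monomial_generators
    (I : S -> Prop) (A : 'X_{1..n} -> Prop) : Prop :=
  ideal_eq I (monomial_gen A) /\
  forall B : 'X_{1..n} -> Prop,
    (forall m, B m -> A m) -> ideal_eq I (monomial_gen B) ->
    forall m, A m -> B m.

(* G(I), as the set of members of the (unique) minimal set of monomial
   generators of I; it is only meaningful when I is a monomial ideal. *)
Definition mingens (I : S -> Prop) : 'X_{1..n} -> Prop :=
  fun m => exists2 A, minimal_monomial_generators I A & A m.

Definition bounded (b : 'rV[int]_n) (m : 'X_{1..n}) : Prop :=
  forall i : 'I_n, (m i)%:Z <= b 0 i.

(* Subtraction of exponents is truncated, but the side condition that x_j
   divides u makes (u - U_(j) + U_(i))%MM the exponent of x_i u / x_j. *)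
Definition bounded_strongly_stable (b : 'rV[int]_n) (I : S -> Prop) : Prop :=
  [/\ monomial_ideal I,
      forall u, mingens I u -> bounded b u &
      forall (u : 'X_{1..n}) (i j : 'I_n),
        mingens I u -> (i < j)%N -> (U_(j) <= u)%MM ->
        bounded b (u - U_(j) + U_(i))%MM -> I 'X_[(u - U_(j) + U_(i))%MM]].

(* The degree is an integer, since d - l may be negative. The zero ideal is
   generated in every degree. *)
Definition generated_in_degree (d : int) (I : S -> Prop) : Prop :=
  monomial_ideal I /\ forall u, mingens I u -> (mdeg u)%:Z = d.

Definition equigenerated (I : S -> Prop) : Prop :=
  ideal_nonzero I /\ exists d, generated_in_degree d I.

Definition colon_maxid (I : S -> Prop) (k : nat) : S -> Prop :=
  ideal_colon I (ideal_exp maxid k).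

(* J_l(I): the ideal generated by the monomials of (I : m^l) \ (I : m^(l-1)),
   with J_0(I) = I. *)
Definition socle_ideal (I : S -> Prop) (l : nat) : S -> Prop :=
  if l is k.+1 then
    monomial_gen
      (fun m => colon_maxid I k.+1 'X_[m] /\ ~ colon_maxid I k 'X_[m])
  else I.

End Ideals.

Definition is_min (P : nat -> Prop) (k : nat) : Prop :=
  P k /\ forall j, P j -> (k <= j)%N.

Definition is_max (P : nat -> Prop) (k : nat) : Prop :=
  P k /\ forall j, P j -> (j <= k)%N.

(* sat(I) = s, stated as a relation so that no default value is needed. *)
Definition is_sat (n : nat) (K : fieldType) (I : {mpoly K[n]} -> Prop)
    (s : nat) : Prop :=
  is_min (fun k => ideal_eq (colon_maxid I k) (colon_maxid I k.+1)) s.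

(* Main.v *)
(* Everything is read off the set M of exponents of monomials in I. If z is
   not in M but all x_i z are, strong stability forces x_n z to be a minimal
   generator, so deg z = d - 1. Hence a monomial v in (I : m^l) \ (I : m^(l-1)),
   which divides some such z with quotient of degree l - 1, has degree d - l;
   then each v x_i^l is a minimal generator, which gives both the bound
   Deg v <= c - l e and v = u / x_n^l with u in G(I). Conversely, from such a u
   the factors x_n can be exchanged one by one for any monomial of degree l. As
   the monomials so obtained have equal degree, they are the minimal generators
   of J_l(I). *)
Require Import Defs.
From Stdlib Require Import Classical.
From mathcomp Require Import all_boot all_order all_algebra zify.
From mathcomp.multinomials Require Import mpoly.
Set Implicit Arguments.
Unset Strict Implicit.
Unset Printing Implicit Defensive.
Import GRing.Theory Num.Theory.
Local Open Scope ring_scope.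

(** * Exponent vectors under divisibility *)

Section Monomials.
Variable n : nat.
Implicit Types m u v w : 'X_{1..n}.

Lemma lem_mdeg m1 m2 : (m1 <= m2)%MM -> (mdeg m1 <= mdeg m2)%N.
Proof. by move=> /submK <-; rewrite mdegD leq_addl. Qed.

Lemma lem_mdeg_eq m1 m2 : (m1 <= m2)%MM -> mdeg m1 = mdeg m2 -> m1 = m2.
Proof.
move=> le12 eqd; have := congr1 mdeg (submK le12); rewrite mdegD eqd => eqm.
have /eqP : mdeg (m2 - m1) == 0%N by lia.
by move/eqP; rewrite mdeg_eq0 => /eqP m0; rewrite -(submK le12) m0 add0m.
Qed.

Lemma lem_anti m1 m2 : (m1 <= m2)%MM -> (m2 <= m1)%MM -> m1 = m2.
Proof.
move=> le12 le21; apply: lem_mdeg_eq => //; apply/eqP.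
by rewrite eqn_leq !lem_mdeg.
Qed.

Lemma mdeg_gt0_split m : (0 < mdeg m)%N -> exists m' i, m = (m' + U_(i))%MM.
Proof.
rewrite lt0n mdeg_eq0 => m0.
have [i mi] : exists i, (0 < m i)%N.
  apply/existsP; apply: contraNT m0; rewrite negb_exists => /forallP m0.
  by apply/eqP/mnmP=> i; rewrite mnm0E; have := m0 i; lia.
exists (m - U_(i))%MM, i; rewrite submK //.
by apply/mnm_lepP=> j; rewrite mnm1E; case: eqVneq => // <-.
Qed.

End Monomials.

#[local] Hint Resolve lepm_refl : core.

(** * Monomial ideals, their minimal generators, and colons by powers of the maximal ideal *)

Section MonomialIdeals.
Variables (n : nat) (K : fieldType).
Local Notation S := {mpoly K[n]}.
Implicit Types (A B : 'X_{1..n} -> Prop) (I : S -> Prop) (f g : S).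

Lemma ideal_gen_ideal (A : S -> Prop) : is_ideal (ideal_gen A).
Proof.
split=> [J [] //|f g If Ig J idJ AJ|r f If J idJ AJ]; have [J0 JD JM] := idJ.
  by apply: JD; [exact: If | exact: Ig].
by apply: JM; exact: If.
Qed.

Lemma ideal_gen_sub (A : S -> Prop) f : A f -> ideal_gen A f.
Proof. by move=> Af J _; apply. Qed.

Lemma ideal_exp_ideal I k : is_ideal (ideal_exp I k).
Proof. by case: k => [|k]; [split | exact: ideal_gen_ideal]. Qed.

Lemma ideal_msupp I f :
  is_ideal I -> (forall m, m \in msupp f -> I 'X_[m]) -> I f.
Proof.
move=> [I0 ID IM] If; rewrite [f]mpolyE big_seq.
by apply: big_ind => // m /If Im; rewrite -mul_mpolyC; exact: IM.
Qed.

(** Each monomial of [r * f] is a multiple of one of [f], so upward closure suffices. These ideals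
    are the test ideals against which generated ideals are compared below. *)
Lemma msupp_pred_ideal (P : 'X_{1..n} -> Prop) :
  (forall m m', P m -> (m <= m')%MM -> P m') ->
  is_ideal (fun f : S => forall m, m \in msupp f -> P m).
Proof.
move=> Pup; split=> [m|f g Pf Pg m|r f Pf m].
- by rewrite msupp0.
- by move/msuppD_le; rewrite mem_cat => /orP[/Pf|/Pg].
move/msuppM_le=> /allpairsP[[m1 m2] /= [_ /Pf Pm2 ->]].
exact: Pup Pm2 (lem_addl _ _).
Qed.

Lemma monomial_genP A f :
  monomial_gen A f <->
  forall m, m \in msupp f -> exists2 a, A a & (a <= m)%MM.
Proof.
split.
  have idJ : is_ideal (fun g : S =>
      forall m, m \in msupp g -> exists2 a, A a & (a <= m)%MM).
    apply: msupp_pred_ideal => m m' [a Aa am] mm'.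
    by exists a => //; exact: lepm_trans am mm'.
  move=> /(_ _ idJ) Af; apply: Af => _ [a Aa ->] m.
  by rewrite msuppX inE => /eqP ->; exists a.
move=> Af; have idA := ideal_gen_ideal (fun f => exists2 m, A m & f = 'X_[m]).
apply: ideal_msupp => // m /Af[a Aa /submK <-]; rewrite mpolyXD.
by case: idA => _ _; apply; apply: ideal_gen_sub; exists a.
Qed.

Lemma monomial_genX A m :
  @monomial_gen n K A 'X_[m] <-> exists2 a, A a & (a <= m)%MM.
Proof.
rewrite monomial_genP; split=> [|Am m']; first by apply; rewrite msuppX inE.
by rewrite msuppX inE => /eqP ->.
Qed.

Lemma monomial_ideal_ideal I : monomial_ideal I -> is_ideal I.
Proof.
move=> [A IA];
have [A0 AD AM] := ideal_gen_ideal (fun f => exists2 m, A m & f = 'X_[m]).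
by split=> [|f g|r f]; rewrite !IA; [exact: A0 | exact: AD | exact: AM].
Qed.

Lemma monomial_ideal_up I m m' :
  monomial_ideal I -> I 'X_[m] -> (m <= m')%MM -> I 'X_[m'].
Proof.
move=> [A IA]; rewrite !IA !monomial_genX => -[a Aa am] mm'.
by exists a => //; exact: lepm_trans am mm'.
Qed.

Lemma monomial_ideal_msupp I f :
  monomial_ideal I -> I f <-> forall m, m \in msupp f -> I 'X_[m].
Proof.
move=> mI; split=> [|If]; last exact: ideal_msupp (monomial_ideal_ideal mI) If.
have [A IA] := mI; rewrite IA monomial_genP => Af m /Af.
by rewrite IA monomial_genX.
Qed.

Lemma monomial_gen_monomial A : monomial_ideal (@monomial_gen n K A).
Proof. by exists A. Qed.

Lemma minimal_below (P : 'X_{1..n} -> Prop) m : P m ->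
  exists u, [/\ P u, (u <= m)%MM & forall v, P v -> (v <= u)%MM -> v = u].
Proof.
have [k] := ubnP (mdeg m); elim: k m => // k IHk m lemk Pm.
have [[v [Pv vm neq]]|nex] :=
  classic (exists v, [/\ P v, (v <= m)%MM & v <> m]).
  have ltd : (mdeg v < mdeg m)%N.
    rewrite ltn_neqAle lem_mdeg // andbT; apply/eqP=> /(lem_mdeg_eq vm) //.
  have [|u [Pu uv minu]] := IHk v _ Pv; first by lia.
  by exists u; split=> //; exact: lepm_trans uv vm.
exists m; split=> // v Pv vm; apply: NNPP => neq; apply: nex; by exists v.
Qed.

(** A generator with a proper divisor in the ideal could be dropped, and a divisibility-minimal
    monomial lies in every monomial generating set. *)
Lemma mingensP I m : monomial_ideal I ->
  mingens I m <->
  I 'X_[m] /\ forall m', I 'X_[m'] -> (m' <= m)%MM -> m' = m.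
Proof.
move=> mI; split=> [[A [IA minA] Am]|[Im minm]].
  split=> [|m' + m'm]; first by rewrite IA monomial_genX; exists m.
  rewrite IA monomial_genX => -[a Aa am']; apply: NNPP => neq.
  have am : a <> m.
    by move=> eam; apply: neq; apply: lem_anti => //; rewrite -eam.
  (* Deleting [m] from [A] keeps the ideal, because [a] properly divides [m]; minimality of [A] then
     puts [m] into the set from which it was deleted. *)
  have [] // : A m /\ m <> m.
  apply: (minA (fun b => A b /\ b <> m)) => // [b []//|f].
  rewrite IA !monomial_genP; split=> Af x /Af [b].
    move=> Ab bx; have [ebm|nbm] := classic (b = m); last by exists b.
    exists a => //; apply: lepm_trans am' (lepm_trans m'm _); by rewrite -ebm.
  by case; exists b.
exists (fun m => I 'X_[m] /\
  forall m', I 'X_[m'] -> (m' <= m)%MM -> m' = m) => //.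
split=> [f|B BA IB u [Iu minu]].
  rewrite monomial_genP (monomial_ideal_msupp _ mI).
  split=> If x /If => [Ix|[a [Ia _]]]; last exact: monomial_ideal_up.
  have [u [Iu ux minu]] := minimal_below (P := fun m => I 'X_[m]) Ix.
  by exists u.
move: (Iu); rewrite IB monomial_genX => -[b Bb bu].
by rewrite -(minu b) //; have [] := BA b Bb.
Qed.

Lemma mingens_below I m : monomial_ideal I -> I 'X_[m] ->
  exists2 u, mingens I u & (u <= m)%MM.
Proof.
move=> mI Im.
have [u [Iu um minu]] := minimal_below (P := fun m => I 'X_[m]) Im.
by exists u => //; apply/mingensP.
Qed.

Lemma mingens_antichain I A :
  ideal_eq I (monomial_gen A) ->
  (forall a b, A a -> A b -> (a <= b)%MM -> a = b) ->
  forall m, mingens I m <-> A m.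
Proof.
move=> IA antiA m; have mI : monomial_ideal I by exists A.
rewrite mingensP // IA monomial_genX; split=> [[[a Aa am] minm]|Am].
  by rewrite -(minm a) // IA monomial_genX; exists a.
split=> [|m']; first by exists m.
rewrite IA monomial_genX => -[a Aa am'] m'm; apply: lem_anti => //.
by rewrite -(antiA a m) //; exact: lepm_trans m'm.
Qed.

Lemma eq_monomial_gen A B : (forall m, A m <-> B m) ->
  ideal_eq (@monomial_gen n K A) (monomial_gen B).
Proof.
by move=> AB f; rewrite !monomial_genP; split=> Af m /Af [a /AB]; exists a.
Qed.

(** Each factor from [maxid] raises degrees by at least one; conversely, variables are split off a
    monomial one at a time. *)
Lemma ideal_exp_maxid k f :
  ideal_exp (@maxid n K) k f <-> forall m, m \in msupp f -> (k <= mdeg m)%N.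
Proof.
have idP j : is_ideal (fun f : S => forall m, m \in msupp f -> (j <= mdeg m)%N).
  by apply: msupp_pred_ideal => m m' jm /lem_mdeg; exact: leq_trans.
split.
  elim: k f => // k IHk f /(_ _ (idP k.+1)) Ef.
  apply: Ef => _ [a [b [ma /IHk mb ->]]] m.
  move=> /msuppM_le/allpairsP[[m1 m2] /= [m1a m2b ->]].
  have : (0 < mdeg m1)%N.
    move: ma m1 m1a => /(_ _ (idP 1)) ma; apply: ma => _ [i ->] m'.
    by rewrite msuppX inE => /eqP ->; rewrite mdeg1.
  by have := mb _ m2b; rewrite mdegD; lia.
move=> kf; apply: ideal_msupp => [|m /kf]; first exact: ideal_exp_ideal.
elim: k m {f kf} => // k IHk m km.
have [|w [i Ew]] := @mdeg_gt0_split _ m; first by lia.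
apply: ideal_gen_sub; exists 'X_i, 'X_[w]; split.
- by apply: ideal_gen_sub; exists i.
- by apply: IHk; move: km; rewrite Ew mdegD mdeg1 addn1.
by rewrite -mpolyXD addmC -Ew.
Qed.

(** Degree exactly [k] is enough: a monomial of larger degree has a divisor of degree [k], and
    membership in [I] passes to multiples. *)
Lemma colon_maxidP I k f : monomial_ideal I ->
  colon_maxid I k f <->
  forall m w, m \in msupp f -> mdeg w = k -> I 'X_[(m + w)%MM].
Proof.
move=> mI; split=> [If m w mf wk|If g].
  have : I (f * 'X_[w]).
    apply: If; apply/ideal_exp_maxid=> m'.
    by rewrite msuppX inE => /eqP ->; rewrite wk.
  rewrite monomial_ideal_msupp //; apply.
  rewrite (perm_mem (msuppMX _ _)); apply/mapP; exists m => //; exact: addmC.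
rewrite ideal_exp_maxid => kg; apply/monomial_ideal_msupp => //.
move=> _ /msuppM_le/allpairsP[[m1 m2] /= [m1f /kg km2 ->]].
have [w [wk wm2]] : exists w, mdeg w = k /\ (w <= m2)%MM.
  elim: k km2 {If kg} => [|k IHk] km2.
    exists 0%MM; rewrite mdeg0; split=> //.
    by apply/mnm_lepP=> i; rewrite mnm0E.
  have [|w [wk wm2]] := IHk; first exact: ltnW.
  have [|w' [i Ew]] := @mdeg_gt0_split _ (m2 - w)%MM.
    by have := congr1 mdeg (submK wm2); rewrite mdegD; lia.
  exists (w + U_(i))%MM; rewrite mdegD mdeg1 wk addn1; split=> //.
  by rewrite -(submK wm2) Ew -addmA [(U_(i) + w)%MM]addmC lem_addl.
apply: (monomial_ideal_up mI (If _ _ m1f wk)).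
by apply/mnm_lepP=> i; rewrite !mnmDE leq_add2l; exact: (mnm_lepP wm2).
Qed.

Lemma colon_maxidX I k m : monomial_ideal I ->
  colon_maxid I k 'X_[m] <-> forall w, mdeg w = k -> I 'X_[(m + w)%MM].
Proof.
move=> mI; rewrite colon_maxidP //; split=> [Im w wk|Im m' w].
  by apply: Im; rewrite ?msuppX ?inE.
by rewrite msuppX inE => /eqP -> /Im.
Qed.

End MonomialIdeals.

(** * Combinatorics of a bounded strongly stable set of exponents *)

Lemma bounded_shift n (c : 'rV[int]_n) l (v : 'X_{1..n}) :
  bounded (c - const_mx 1 *+ l) v <-> forall i, (v i + l)%:Z <= c 0 i.
Proof.
have E i : (c - const_mx 1 *+ l) 0 i = c 0 i - l%:Z.
  by rewrite !mxE mulmxnE mxE natz.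
by split=> vb i; have := vb i; rewrite E; lia.
Qed.

Section StableMonomials.
Variables (n : nat) (c : 'rV[int]_n.+1) (d : nat) (M : 'X_{1..n.+1} -> Prop).
Implicit Types u v w z : 'X_{1..n.+1}.

(** The elements of [M] of degree [d] take the place of G(I), which keeps polynomials out of the
    argument. *)
Hypothesis M_up : forall u v, M u -> (u <= v)%MM -> M v.
Hypothesis M_gen : forall v, M v ->
  exists u, [/\ M u, mdeg u = d, bounded c u & (u <= v)%MM].
Hypothesis M_stable : forall u (i j : 'I_n.+1),
  M u -> mdeg u = d -> (i < j)%N -> (U_(j) <= u)%MM ->
  bounded c (u - U_(j) + U_(i))%MM -> M (u - U_(j) + U_(i))%MM.

Lemma stable_bounded u : M u -> mdeg u = d -> bounded c u.
Proof.
by move=> /M_gen[u' [_ du' bu' le]] du; rewrite -(lem_mdeg_eq le) // du du'.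
Qed.

Lemma stable_mdeg u : M u -> (d <= mdeg u)%N.
Proof. by move=> /M_gen[u' [_ <- _]]; exact: lem_mdeg. Qed.

(** A generator dividing x_i z but having exponent at most [z i] at [i] would divide [z]. *)
Lemma socle_generator z i : ~ M z -> M (z + U_(i))%MM ->
  exists g, [/\ M g, mdeg g = d, bounded c g,
    (g <= z + U_(i))%MM & g i = (z i).+1].
Proof.
move=> nMz /M_gen[g [Mg dg bg le]]; exists g; split=> //.
have := mnm_lepP le i; rewrite mnmDE mnm1E eqxx addn1 leq_eqVlt.
case/orP=> [/eqP //|lti].
case: nMz; apply: M_up Mg _; apply/mnm_lepP=> j; have := mnm_lepP le j.
by rewrite mnmDE mnm1E; case: eqVneq lti => [->|_]; lia.
Qed.

(* If the generator g below x_n z were a proper divisor of it, then some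
   x_j g / x_n would divide z; it is bounded because x_j z lies above a
   generator too. *)
Lemma socle_mdeg z : ~ M z -> (forall i, M (z + U_(i))%MM) -> (mdeg z).+1 = d.
Proof.
move=> nMz socz.
have [g [Mg dg bg le gn]] := socle_generator nMz (socz ord_max).
have [eqd|neqd] := eqVneq (mdeg g) (mdeg (z + U_(ord_max))).
  by rewrite -dg eqd mdegD mdeg1 addn1.
have [j ltj] : exists j, (g j < (z + U_(ord_max))%MM j)%N.
  apply/existsP; apply: contraNT neqd; rewrite negb_exists => /forallP nlt.
  apply/eqP; congr mdeg; apply/mnmP=> j.
  by have := nlt j; have := mnm_lepP le j; lia.
have jn : j != ord_max.
  by apply: contraTneq ltj => ->; rewrite gn mnmDE mnm1E eqxx addn1 ltnn.
move: ltj; rewrite mnmDE mnm1E eq_sym (negPf jn) addn0 => ltj.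
have ltjn : (j < n)%N.
  by have := ltn_ord j; move: jn; rewrite -val_eqE /=; lia.
have [h [_ _ bh _ hj]] := socle_generator nMz (socz j).
case: nMz; apply: (M_up (u := (g - U_(ord_max) + U_(j))%MM)).
  apply: M_stable => //.
    by apply/mnm_lepP=> i; rewrite mnm1E; case: eqVneq => // <-; rewrite gn.
  move=> i; rewrite mnmDE mnmBE !mnm1E; have := bg i; have := bh j.
  by case: (eqVneq j i) => [<-|_]; lia.
apply/mnm_lepP=> i; have := mnm_lepP le i; rewrite !mnmDE mnmBE !mnm1E.
case: (eqVneq ord_max i) => [<-|_]; first by rewrite (negPf jn); lia.
by case: (eqVneq j i) => [<-|_]; lia.
Qed.

(** A [w] of degree [k] with [v + w] outside [M] makes [v + w] a socle monomial, to which
    [socle_mdeg] applies. *)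
Lemma colon_mdeg v k :
  (forall w, mdeg w = k.+1 -> M (v + w)%MM) ->
  ~ (forall w, mdeg w = k -> M (v + w)%MM) -> (mdeg v + k.+1)%N = d.
Proof.
move=> Mv /not_all_ex_not nMv; have [w nMvw] := nMv.
have [dw nMw] := imply_to_and _ _ nMvw.
rewrite addnS -dw -mdegD; apply: socle_mdeg nMw _ => i.
by rewrite -addmA; apply: Mv; rewrite mdegD mdeg1 dw addn1.
Qed.

(** Taking for [w] the power x_i^l gives a generator v x_i^l; its bound at [i] is the required
    one. *)
Lemma bounded_shiftP v l : (mdeg v + l)%N = d ->
  (forall w, mdeg w = l -> M (v + w)%MM) ->
  bounded (c - const_mx 1 *+ l) v.
Proof.
move=> dv Mv; apply/bounded_shift => i.
have dU : mdeg (U_(i) *+ l : 'X_{1..n.+1})%MM = l by rewrite mdegMn mdeg1 mul1n.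
have := @stable_bounded (v + U_(i) *+ l)%MM (Mv _ dU).
by rewrite mdegD dU => /(_ dv i); rewrite mnmDE mulmnE mnm1E eqxx mul1n.
Qed.

(* The factors x_n of v x_n^l are exchanged one at a time for those of w. *)
Lemma stable_exchange v l : (mdeg v + l)%N = d ->
  M (v + U_(ord_max) *+ l)%MM -> bounded (c - const_mx 1 *+ l) v ->
  forall w, mdeg w = l -> M (v + w)%MM.
Proof.
move=> dv Mvl /bounded_shift bv.
suff exch k w : (mdeg w + k)%N = l -> M (v + w + U_(ord_max) *+ k)%MM.
  move=> w dw; rewrite -[(v + w)%MM]addm0 -(mulm0n U_(ord_max)).
  by apply: exch; rewrite addn0.
have [N] := ubnP (mdeg w); elim: N => // N IHN in w k *.
rewrite ltnS => dwN dwk.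
have [w0|w_gt0] := posnP (mdeg w).
  move: dwk; rewrite w0 add0n => ->.
  by move/eqP: w0; rewrite mdeg_eq0 => /eqP ->; rewrite addm0.
have [w' [i Ew]] := mdeg_gt0_split w_gt0; subst w.
move: dwN dwk; rewrite mdegD mdeg1 => dwN dwk.
have := IHN w' k.+1; rewrite !mulmS => /(_ ltac:(lia) ltac:(lia)) Mw'.
have [->|ni] := eqVneq i ord_max.
  by rewrite -!addmA; rewrite -!addmA in Mw'.
have -> : (v + (w' + U_(i)) + U_(ord_max) *+ k =
           v + w' + (U_(ord_max) + U_(ord_max) *+ k) - U_(ord_max) + U_(i))%MM.
  apply/mnmP=> j; rewrite !(mnmDE, mnmBE); lia.
apply: M_stable => //.
- by rewrite !mdegD mdegMn !mdeg1; lia.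
- by have := ltn_ord i; move: ni; rewrite -val_eqE /=; lia.
- by apply/mnm_lepP=> j; rewrite !mnmDE; lia.
(* No exponent grows by more than [l] over that of [v]: the increase is at most [mdeg w' + 1] away
   from x_n and at most [mdeg w' + k] at x_n. *)
move=> j; have := bv j; have := dwk.
have : (w' j <= mdeg w')%N by rewrite mdegE (bigD1 j) //= leq_addr.
rewrite !(mnmDE, mnmBE, mulmnE, mnm1E).
by case: eqVneq ni => [->|_]; case: eqVneq => //=; lia.
Qed.

(** Multiplication by x_n^l commutes with the exchange, and the slack [l] in the shifted bound
    absorbs the factor x_n^l. *)
Lemma stable_shift u (i j : 'I_n.+1) l :
  M (u + U_(ord_max) *+ l)%MM -> (mdeg u + l)%N = d -> (i < j)%N ->
  (U_(j) <= u)%MM -> bounded (c - const_mx 1 *+ l) (u - U_(j) + U_(i))%MM ->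
  M (u - U_(j) + U_(i) + U_(ord_max) *+ l)%MM.
Proof.
move=> Mu du ij ju /bounded_shift bu; have leju k := mnm_lepP ju k.
have -> : (u - U_(j) + U_(i) + U_(ord_max) *+ l =
           u + U_(ord_max) *+ l - U_(j) + U_(i))%MM.
  by apply/mnmP=> k; have := leju k; rewrite !(mnmDE, mnmBE); lia.
apply: M_stable => //.
- by rewrite mdegD mdegMn mdeg1 mul1n.
- by apply: lepm_trans ju (lem_addr _ _).
move=> k; have := bu k; have := leju k.
by rewrite !(mnmDE, mnmBE, mulmnE, mnm1E); case: (ord_max == k); lia.
Qed.

(** For the monomials of an ideal, the left side describes (I : m^(k+1)) \ (I : m^k) and the right
    side the quotients u / x_n^(k+1) of the theorem. *)
Lemma colon_stepP v k :
  ((forall w, mdeg w = k.+1 -> M (v + w)%MM) /\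
   ~ (forall w, mdeg w = k -> M (v + w)%MM)) <->
  [/\ M (v + U_(ord_max) *+ k.+1)%MM, (mdeg v + k.+1)%N = d &
      bounded (c - const_mx 1 *+ k.+1) v].
Proof.
split=> [[Mv nMv]|[Mv dv bv]].
  have dv := colon_mdeg Mv nMv; split=> //; last exact: bounded_shiftP.
  by apply: Mv; rewrite mdegMn mdeg1 mul1n.
split=> [|Mk]; first exact: stable_exchange.
(* The monomial v x_n^k has degree d - 1, too small for [M]. *)
have := @stable_mdeg (v + U_(ord_max) *+ k)%MM.
rewrite mdegD mdegMn mdeg1 mul1n => /(_ (Mk _ _)).
by rewrite mdegMn mdeg1 mul1n => /(_ erefl); lia.
Qed.

End StableMonomials.

Theorem theorem2p3 (K : fieldType) (n : nat) (c : 'rV[int]_n.+1)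
    (I : {mpoly K[n.+1]} -> Prop) (d : nat)
    (hc : forall i, 0 <= c 0 i)
    (hequi : equigenerated I)
    (hstable : bounded_strongly_stable c I)
    (hdeg : generated_in_degree d%:Z I) :
  (forall l : nat, (1 <= l)%N ->
     [/\ bounded_strongly_stable (c - const_mx 1 *+ l) (socle_ideal I l),
         generated_in_degree (d%:Z - l%:Z) (socle_ideal I l) &
         ideal_nonzero (socle_ideal I l.-1) ->
         ideal_eq (socle_ideal I l)
           (monomial_gen (fun v => exists u : 'X_{1..n.+1},
              [/\ mingens I u, (U_(ord_max) *+ l <= u)%MM,
                  v = (u - U_(ord_max) *+ l)%MM &
                  bounded (c - const_mx 1 *+ l) v]))]) /\
  (exists s : nat,
     is_sat I s /\
     is_max (fun l => exists u : 'X_{1..n.+1},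
       [/\ mingens I u, (U_(ord_max) *+ l <= u)%MM &
           bounded (c - const_mx 1 *+ l) (u - U_(ord_max) *+ l)%MM]) s).
Proof.
have [mI mI_bounded mI_stable] := hstable.
have [[f If f0] _] := hequi.
have [_ mI_deg] := hdeg.
pose M v := I 'X_[v].
have M_up u v : M u -> (u <= v)%MM -> M v by exact: monomial_ideal_up.
(* Since all generators have degree [d], a monomial of [I] of that degree has no proper divisor in
   [I]. *)
have GM u : mingens I u <-> M u /\ mdeg u = d.
  rewrite mingensP //; split=> [Gu|[Mu du]].
    have /mI_deg [<-] : mingens I u by apply/mingensP.
    by split=> //; case: Gu.
  split=> // v Mv vu; have [w Gw wv] := mingens_below mI Mv.
  apply: lem_mdeg_eq => //; apply/eqP; rewrite eqn_leq lem_mdeg //= du.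
  by have [<-] := mI_deg w Gw; exact: lem_mdeg.
have M_gen v : M v ->
    exists u, [/\ M u, mdeg u = d, bounded c u & (u <= v)%MM].
  move=> /(mingens_below mI)[u Gu uv]; exists u.
  by have [Mu du] := proj1 (GM u) Gu; split=> //; exact: mI_bounded.
have M_stable u (i j : 'I_n.+1) : M u -> mdeg u = d -> (i < j)%N ->
    (U_(j) <= u)%MM -> bounded c (u - U_(j) + U_(i))%MM ->
    M (u - U_(j) + U_(i))%MM.
  by move=> Mu du; apply: mI_stable; apply/GM.
(* The quotients u / x_n^l, stated through u = v x_n^l to avoid truncated subtraction. *)
pose R l v := [/\ M (v + U_(ord_max) *+ l)%MM, (mdeg v + l)%N = d &
  bounded (c - const_mx 1 *+ l) v].
have RE l v : (exists u : 'X_{1..n.+1},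
    [/\ mingens I u, (U_(ord_max) *+ l <= u)%MM,
        v = (u - U_(ord_max) *+ l)%MM & bounded (c - const_mx 1 *+ l) v]) <->
    R l v.
  split=> [[u [/GM[Mu du] le Ev bv]]|[Mv dv bv]].
    have Eu : (v + U_(ord_max) *+ l = u)%MM by rewrite Ev submK.
    by split=> //; rewrite ?Eu // -du -Eu mdegD mdegMn mdeg1 mul1n.
  exists (v + U_(ord_max) *+ l)%MM; rewrite addmK lem_addl; split=> //.
  by apply/GM; rewrite mdegD mdegMn mdeg1 mul1n.
have colonR k v :
    (colon_maxid I k.+1 'X_[v] /\ ~ colon_maxid I k 'X_[v]) <-> R k.+1 v.
  by rewrite !colon_maxidX //; exact: (colon_stepP M_up M_gen M_stable).
have socleE k : ideal_eq (socle_ideal I k.+1) (monomial_gen (R k.+1)).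
  exact: eq_monomial_gen (colonR k).
(* The generating monomials share the degree d - (k+1), so none properly divides another. *)
have socleG k v : mingens (socle_ideal I k.+1) v <-> R k.+1 v.
  apply: mingens_antichain => // a b [_ da _] [_ db _] ab.
  by apply: lem_mdeg_eq => //; lia.
split=> [[|k] // _|].
  have mJ : monomial_ideal (socle_ideal I k.+1) by exact: monomial_gen_monomial.
  split.
  - split=> // [u /socleG[]//|u i j /socleG[Mu du bu] ij ju bu'].
    rewrite socleE monomial_genX.
    exists (u - U_(j) + U_(i))%MM => //; split=> //.
      exact: (stable_shift M_stable).
    by rewrite mdegD mdeg1 -du -[in RHS](submK ju) mdegD mdeg1.
  - by split=> // u /socleG[_ du _]; rewrite -du PoszD addrK.
  move=> _ g; rewrite socleE.
  by have := @eq_monomial_gen _ K _ _ (RE k.+1) g => ->.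
pose P l := exists v, R l v.
have PE l : (exists u : 'X_{1..n.+1},
    [/\ mingens I u, (U_(ord_max) *+ l <= u)%MM &
        bounded (c - const_mx 1 *+ l) (u - U_(ord_max) *+ l)%MM]) <-> P l.
  split=> [[u [Gu le bu]]|[v /RE[u [Gu le -> bu]]]]; last by exists u.
  by exists (u - U_(ord_max) *+ l)%MM; apply/RE; exists u.
have P0 : P 0%N.
  have [v vf] : exists v, v \in msupp f.
    case E : (msupp f) => [|v s]; last by exists v; rewrite inE eqxx.
    by move: f0; rewrite -msupp_eq0 E.
  have /M_gen[u [Mu du bu _]] : M v.
    exact: (proj1 (monomial_ideal_msupp f mI)).
  by exists u; split; rewrite ?mulm0n ?addm0 ?addn0 // mulr0n subr0.
(* Replacing [v] by x_n v is allowed: every bound loosens by one, which pays for the extra x_n. *)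
have Pdown l : P l.+1 -> P l.
  move=> [v [Mv dv /bounded_shift bv]]; exists (v + U_(ord_max))%MM; split.
  - by rewrite -addmA -mulmS.
  - by rewrite mdegD mdeg1 -dv addnAC addn1 addnS.
  apply/bounded_shift => i; have := bv i; rewrite mnmDE mnm1E.
  by case: eqVneq => _; lia.
have Ple l k : P l -> (k <= l)%N -> P k.
  move=> Pl kl; move: Pl; rewrite -(subnKC kl).
  elim: (l - k)%N => [|j IHj]; first by rewrite addn0.
  by rewrite addnS => /Pdown.
have Pd l : P l -> (l <= d)%N by move=> [v [_ <- _]]; exact: leq_addl.
(* [P] is only a proposition, so the maximum is found by descending, with excluded middle, from
   [d.+1], where [P] fails. *)
have [s [Ps maxs]] : exists s, is_max P s.
  have Pbound k : ~ P k -> exists s, is_max P s.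
    elim: k => // k IHk nP; have [Pk|/IHk //] := classic (P k).
    exists k; split=> // j Pj.
    by rewrite leqNgt; apply/negP=> /(Ple _ _ Pj).
  by apply: (Pbound d.+1) => /Pd; rewrite ltnn.
(* The colons differ exactly when some monomial lies in their difference. The shift to [k.+1] makes
   the least stable [k] equal to the largest index satisfying [P]. *)
have satP k : ideal_eq (colon_maxid I k) (colon_maxid I k.+1) <-> ~ P k.+1.
  split=> [eqk [v /colonR[Iv]]|nP g]; first by rewrite eqk.
  rewrite !colon_maxidP //; split=> [Ig m w mg dw|Ig m w mg].
    have [|w' [i Ew]] := @mdeg_gt0_split _ w; first by rewrite dw.
    apply: (M_up (m + w')%MM); last by rewrite Ew addmA lem_addr.
    by apply: Ig => //; move: dw; rewrite Ew mdegD mdeg1 addn1 => -[].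
  move: w; rewrite -colon_maxidX //; apply: NNPP => nI; apply: nP.
  exists m; apply/colonR; split=> //; apply/colon_maxidX => // w; exact: Ig.
exists s; split; split.
- by apply/satP=> /maxs; rewrite ltnn.
(* For j < s, downward closure from [s] would give [P j.+1]. *)
- by move=> j /satP nP; rewrite leqNgt; apply/negP=> /(Ple _ _ Ps).
- exact/PE.
- by move=> j /PE /maxs.
Qed.
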